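(* Let $\mathfrak{q}=\mathfrak{l}\oplus\mathfrak{g}(1)\oplus\mathfrak{z}(\mathfrak{n})$ be a maximal parabolic subalgebra of quasi-Heisenberg type of one of the types $B_n(i)$ ($3\le i\le n$), $C_n(i)$ ($2\le i\le n-1$), $D_n(i)$ ($3\le i\le n-3$), $E_6(3)$, $E_6(5)$, $E_7(2)$, $E_7(6)$, $E_8(1)$, $F_4(4)$, and let $\alpha_\mathfrak{q}$ be the simple root that parametrizes $\mathfrak{q}$. If $V(\mu+\epsilon)$ is a special constituent of $\mathfrak{l}\otimes\mathfrak{z}(\mathfrak{n})$ of type 1a, then for any $\alpha\in\Delta_{\mu+\epsilon}(\mathfrak{g}(1))\setminus\{\mu,\epsilon\}$ and any $\gamma_j\in\Delta_{\mu+\epsilon}(\mathfrak{z}(\mathfrak{n}))$, $$N_{\alpha,-\gamma_j}\,N_{\mu,-\alpha}\,N_{-\theta(\gamma_j),\theta(\alpha)}\,N_{-\theta(\alpha),\theta(\mu)}=N_{\mu,\epsilon-\gamma_j}\,N_{\epsilon,-\gamma_j}\,\frac{\|\alpha_\mathfrak{q}\|^2}{2},$$ where $\theta(\beta)=(\mu+\epsilon)-\beta$.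
   Context: $\mathfrak{g}$ is a complex simple Lie algebra with Borel subalgebra $\mathfrak{b}\supset\mathfrak{h}$ (Cartan), roots $\Delta$, simple roots $\Pi$, Killing form $\kappa$, induced form $\langle\cdot,\cdot\rangle$ on $\mathfrak{h}^*$, $\|\alpha\|^2=\langle\alpha,\alpha\rangle$. ''$\mathfrak{q}$ is of type $\mathcal{T}(i)$'' means $\mathfrak{g}$ has type $\mathcal{T}$ and $\mathfrak{q}=\mathfrak{l}\oplus\mathfrak{n}$ is the standard maximal parabolic determined by $\alpha_\mathfrak{q}=\alpha_i$ (Bourbaki numbering): $\mathfrak{l}=\mathfrak{h}$ plus root spaces for roots in $\mathrm{span}(\Pi\setminus\{\alpha_\mathfrak{q}\})$, $\mathfrak{n}$ the remaining positive root spaces. Quasi-Heisenberg type: $[\mathfrak{n},[\mathfrak{n},\mathfrak{n}]]=0$, $\dim[\mathfrak{n},\mathfrak{n}]>1$. $\mathfrak{n}=\mathfrak{g}(1)\oplus\mathfrak{z}(\mathfrak{n})$, where $\mathfrak{g}(1)$ (resp. the center $\mathfrak{z}(\mathfrak{n})$) is the sum of the root spaces of roots with $\alpha_\mathfrak{q}$-coefficient $1$ (resp. $2$). $L$ is the Levi subgroup with Lie algebra $\mathfrak{l}$, acting by $\mathrm{Ad}$. $\Delta(W)$ denotes the roots whose root spaces lie in $W$, and $\Delta_\nu(W)=\{\alpha\in\Delta(W):\nu-\alpha\in\Delta\}$. $\mu$ is the highest weight of the irreducible $L$-module $\mathfrak{g}(1)$ and $\gamma$ (the highest root) that of $\mathfrak{z}(\mathfrak{n})$.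 An irreducible $L$-constituent $V(\nu)$ (highest weight $\nu$) of $\mathfrak{l}\otimes\mathfrak{z}(\mathfrak{n})$ is special if $\nu\neq\gamma$ and $\nu=\mu+\epsilon$ for some $\epsilon\in\Delta(\mathfrak{g}(1))$; it is of type 1a if $\mu+\epsilon\notin\Delta$, $\epsilon\neq\mu$, and both $\mu$ and $\epsilon$ are long roots (all roots are regarded as long if $\mathfrak{g}$ is simply laced). Normalization. Root vectors $X_\alpha\in\mathfrak{g}_\alpha$ and $H_\alpha\in\mathfrak{h}$ ($\alpha\in\Delta$) are chosen with $[X_\alpha,X_{-\alpha}]=H_\alpha$, $\kappa(X_\alpha,X_{-\alpha})=1$, $\beta(H_\alpha)=\langle\alpha,\beta\rangle$; $[X_\alpha,X_\beta]=N_{\alpha,\beta}X_{\alpha+\beta}$ if $\alpha+\beta\in\Delta$, and $N_{\alpha,\beta}=0$ if $\alpha+\beta\notin\Delta$, $\alpha+\beta\neq0$; $N_{\alpha_1,\alpha_2}=N_{\alpha_2,\alpha_3}=N_{\alpha_3,\alpha_1}$ for roots with $\alpha_1+\alpha_2+\alpha_3=0$; and $N_{\alpha,\beta}N_{-\alpha,-\beta}=-\frac{q_{\alpha,\beta}(1+p_{\alpha,\beta})}{2}\|\alpha\|^2$ if $\alpha+\beta\in\Delta$, where $p_{\alpha,\beta}$ (resp. $q_{\alpha,\beta}$) is the largest $j\ge0$ with $\beta-j\alpha\in\Delta$ (resp. $\beta+j\alpha\in\Delta$). *)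

(* Defs.v *)
From HB Require Import structures.
From mathcomp Require Import all_boot all_order all_algebra.
From mathcomp Require Import complex.
From mathcomp Require Import boolp classical_sets reals.

Set Implicit Arguments.
Unset Strict Implicit.
Unset Printing Implicit Defensive.

Import Order.TTheory GRing.Theory Num.Theory.
Local Open Scope ring_scope.

HB.mixin Record isLieAlgebra (C : fieldType) g of Vector C g := {
  lie : g -> g -> g;
  lie_linearl : forall y, linear (lie^~ y);
  lie_linearr : forall x, linear (lie x);
  liexx : forall x, lie x x = 0;
  lie_jacobi : forall x y z,
    lie x (lie y z) + lie y (lie z x) + lie z (lie x y) = 0
}.

#[short(type="lieAlgType")]
HB.structure Definition LieAlgebra (C : fieldType) :=
  {g of isLieAlgebra C g & Vector C g}.

HB.instance Definition _ (C : fieldType) (g : lieAlgType C) (x : g) :=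
  GRing.isSemilinear.Build C g g *:%R (lie x)
    (GRing.semilinear_linear (lie_linearr x)).

Section LieAlgebraTheory.
Variables (C : fieldType) (g : lieAlgType C).
Implicit Types (x y : g) (U W I : {vspace g}).

Definition ad x : 'End(g) := linfun (lie x).

Lemma adE x y : ad x y = lie x y.
Proof. by rewrite lfunE. Qed.

Definition lie_prod U W : {vspace g} :=
  <<[seq lie x y | x <- vbasis U, y <- vbasis W]>>%VS.

Definition lie_ideal I : Prop := forall x y, y \in I -> lie x y \in I.

Definition lie_simple : Prop :=
  (exists x y, lie x y <> 0) /\
  (forall I, lie_ideal I -> I = 0%VS \/ I = fullv).

(* The trace of [ad x \o ad y], computed in the basis [vbasis fullv]. *)
Definition killing x y : C :=
  \sum_j coord (vbasis {:g}) j ((ad x \o ad y)%VF (vbasis {:g})`_j).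

Definition diagonalizable_end (f : 'End(g)) : Prop :=
  exists2 e : seq g, basis_of fullv e &
    forall v, v \in e -> exists c : C, f v = c *: v.

(* Cartan subalgebra of a semisimple Lie algebra: a maximal abelian subalgebra
   all of whose elements are ad-diagonalizable (Helgason, Ch. III, 3). *)
Definition cartan_subalgebra (h : {vspace g}) : Prop :=
  [/\ forall x y, x \in h -> y \in h -> lie x y = 0,
      forall x, (forall y, y \in h -> lie x y = 0) -> x \in h &
      forall x, x \in h -> diagonalizable_end (ad x)].

End LieAlgebraTheory.

Section Roots.
Variables (C : numFieldType) (g : lieAlgType C) (h : {vspace g}).
Local Notation hdual := 'Hom(subvs_of h, C^o).
Implicit Types (alpha beta lambda nu : hdual).

Definition root_space alpha : {vspace g} :=
  (\bigcap_(H <- vbasis {:subvs_of h})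
     lker (ad (vsval H) - (alpha H : C) *: \1)%VF)%VS.

Lemma root_spaceP alpha (x : g) :
  reflect (forall H : subvs_of h, lie (vsval H) x = (alpha H : C) *: x)
          (x \in root_space alpha).
Proof.
apply: (iffP idP) => [|xP].
- rewrite /root_space => xS H.
  have basisP H0 : H0 \in vbasis {:subvs_of h} ->
      lie (vsval H0) x = (alpha H0 : C) *: x.
    move=> H0b; have : x \in lker (ad (vsval H0) - (alpha H0 : C) *: \1)%VF.
      by move: xS; rewrite (big_rem H0 H0b) /= memv_cap => /andP[].
    rewrite memv_ker !lfunE /= opp_lfunE scale_lfunE id_lfunE adE subr_eq0.
    by move/eqP.
  rewrite (coord_vbasis (memvf H)) !linear_sum /= scaler_suml.
  have lieDl u v : lie (u + v) x = lie u x + lie v x :> g.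
    by have := lie_linearl x 1 u v; rewrite !scale1r.
  have lie0l : lie 0 x = 0 :> g.
    by have /eqP := lieDl 0 0; rewrite addr0 eq_sym -subr_eq0 addrK => /eqP.
  have lieZl c (u : g) : lie (c *: u) x = c *: lie u x.
    by have := lie_linearl x c u 0; rewrite /= lie0l !addr0.
  rewrite (big_morph (fun u : g => lie u x) lieDl lie0l).
  apply: eq_bigr => j _; rewrite linearZ /= lieZl basisP; last first.
    by apply: mem_nth; rewrite size_tuple.
  by rewrite scalerA.
- rewrite /root_space.
  apply: (big_ind (fun U : {vspace g} => x \in U)) => [|U W xU xW|H _].
  + exact: memvf.
  + by rewrite memv_cap xU.
  + rewrite memv_ker !lfunE /= opp_lfunE scale_lfunE id_lfunE adE subr_eq0.
    by rewrite xP.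
Qed.

Definition is_root alpha : bool :=
  (alpha != 0) && (root_space alpha != 0%VS).

(* The element of h representing a functional through the Killing form. *)
Definition killing_repr lambda : subvs_of h :=
  xget 0 [set t | forall H, killing (vsval t) (vsval H) = lambda H]%classic.

Definition root_form lambda nu : C :=
  killing (vsval (killing_repr lambda)) (vsval (killing_repr nu)).

Variable Delta : seq hdual.

Definition enumerates_roots : Prop :=
  forall alpha, (alpha \in Delta) = is_root alpha.

Definition roots_of (W : {vspace g}) : seq hdual :=
  [seq alpha <- Delta | (root_space alpha <= W)%VS].

Definition roots_of_at nu (W : {vspace g}) : seq hdual :=
  [seq alpha <- roots_of W | nu - alpha \in Delta].

(* A root of maximal length; in the simply laced case every root is long. *)
Definition long_root alpha : Prop :=
  alpha \in Delta /\
  forall beta, beta \in Delta -> root_form beta beta <= root_form alpha alpha.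

(* [n] is the largest j >= 0 with beta + j alpha a root; with - alpha in place
   of alpha this gives the number p of the root string. *)
Definition string_end alpha beta (n : nat) : Prop :=
  beta + alpha *+ n \in Delta /\
  (forall j : nat, beta + alpha *+ j \in Delta -> (j <= n)%N).

Record root_normalization (X : hdual -> g) (Hc : hdual -> subvs_of h)
    (N : hdual -> hdual -> C) : Prop := {
  rn_root_vector : forall alpha, alpha \in Delta ->
    X alpha \in root_space alpha;
  rn_coroot : forall alpha, alpha \in Delta ->
    lie (X alpha) (X (- alpha)) = vsval (Hc alpha);
  rn_killing : forall alpha, alpha \in Delta ->
    killing (X alpha) (X (- alpha)) = 1;
  rn_eval : forall alpha beta, alpha \in Delta -> beta \in Delta ->
    beta (Hc alpha) = root_form alpha beta;
  rn_bracket : forall alpha beta, alpha \in Delta -> beta \in Delta ->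
    alpha + beta \in Delta ->
    lie (X alpha) (X beta) = N alpha beta *: X (alpha + beta);
  rn_zero : forall alpha beta, alpha \in Delta -> beta \in Delta ->
    alpha + beta \notin Delta -> alpha + beta != 0 -> N alpha beta = 0;
  rn_cyclic : forall a1 a2 a3, a1 \in Delta -> a2 \in Delta -> a3 \in Delta ->
    a1 + a2 + a3 = 0 -> N a1 a2 = N a2 a3 /\ N a2 a3 = N a3 a1;
  rn_product : forall alpha beta (p q : nat),
    alpha \in Delta -> beta \in Delta -> alpha + beta \in Delta ->
    string_end (- alpha) beta p -> string_end alpha beta q ->
    N alpha beta * N (- alpha) (- beta) =
      - ((q * (1 + p))%:R / 2 * root_form alpha alpha)
}.

Variables (n : nat) (Pi : n.-tuple hdual).

(* Choosing simple roots amounts to choosing a Borel subalgebra containing h. *)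
Definition simple_system : Prop :=
  [/\ {subset Pi <= Delta}, basis_of fullv Pi &
      forall beta, beta \in Delta -> exists c : 'I_n -> nat,
        beta = \sum_j tnth Pi j *+ c j \/ beta = - \sum_j tnth Pi j *+ c j].

Definition positive_root beta : bool :=
  (beta \in Delta) && [forall j, 0 <= coord Pi j beta].

Definition is_highest_root gamma : Prop :=
  gamma \in Delta /\
  forall beta j, beta \in Delta -> coord Pi j beta <= coord Pi j gamma.

Variable iq : 'I_n.

Definition alpha_q : hdual := tnth Pi iq.

Definition levi_root beta : bool :=
  (beta \in Delta) &&
  (beta \in <<[seq alpha <- Pi | alpha != alpha_q]>>%VS).

Definition levi_alg : {vspace g} :=
  (h + \sum_(beta <- Delta | levi_root beta) root_space beta)%VS.

Definition nilradical : {vspace g} :=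
  (\sum_(beta <- Delta | positive_root beta && ~~ levi_root beta)
     root_space beta)%VS.

Definition g1 : {vspace g} :=
  (\sum_(beta <- Delta | coord Pi iq beta == 1) root_space beta)%VS.

Definition z_n : {vspace g} :=
  (\sum_(beta <- Delta | coord Pi iq beta == 2) root_space beta)%VS.

Definition quasi_heisenberg : Prop :=
  lie_prod nilradical (lie_prod nilradical nilradical) = 0%VS /\
  (1 < \dim (lie_prod nilradical nilradical))%N.

Definition exp_partial (A : 'End(g)) (m : nat) (x : g) : g :=
  \sum_(k < m) (k`!%:R)^-1 *: iter k A x.

(* [E] is the sum of the exponential series of [A]: convergence is tested
   against all linear functionals, i.e. coordinatewise. *)
Definition is_exp (A E : 'End(g)) : Prop :=
  forall (phi : 'Hom(g, C^o)) (x : g) (e : C), 0 < e ->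
  exists m0 : nat, forall m : nat, (m0 <= m)%N ->
    `|(phi (exp_partial A m x) - phi (E x) : C)| < e.

(* The image Ad(L) of the Levi subgroup in GL(g): L is connected with Lie
   algebra l, so Ad(L) is generated by the exponentials of ad(l). The set of
   these generators is closed under inverses. *)
Inductive levi_group : 'End(g) -> Prop :=
| levi_group1 : levi_group \1%VF
| levi_groupM : forall (x : g) (E a : 'End(g)),
    x \in levi_alg -> is_exp (ad x) E -> levi_group a ->
    levi_group (E \o a)%VF.

(* Below, [rho] is the action on M of the group, through its adjoint image, and
   [drho] the corresponding action of the Lie algebra. *)
Section Module.
Variables (M : vectType C) (rho : 'End(g) -> M -> M) (drho : g -> M -> M).

Definition levi_stable (W : {vspace M}) : Prop :=
  forall a v, levi_group a -> v \in W -> rho a v \in W.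

Definition levi_irreducible (W : {vspace M}) : Prop :=
  [/\ W != 0%VS, levi_stable W &
      forall U : {vspace M}, (U <= W)%VS -> levi_stable U ->
        U = 0%VS \/ U = W].

Definition has_highest_weight (W : {vspace M}) nu : Prop :=
  exists v : M, [/\ v \in W, v != 0,
    forall H : subvs_of h, drho (vsval H) v = (nu H : C) *: v &
    forall beta x, levi_root beta -> positive_root beta ->
      x \in root_space beta -> drho x v = 0].

End Module.

Definition is_highest_weight_g1 mu : Prop :=
  has_highest_weight (@lie C g) g1 mu.

(* The tensor product of g with itself, as Hom(g^*, g): the tensor of x and y
   is the map phi |-> phi(y) x. *)
Definition tensor_sq := 'Hom('Hom(g, C^o), g).

Definition tens (x y : g) : tensor_sq :=
  linfun (fun phi : 'Hom(g, C^o) => (phi y : C) *: x).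

Definition transpose_end (a : 'End(g)) : 'End('Hom(g, C^o)) :=
  linfun (fun phi : 'Hom(g, C^o) => (phi \o a)%VF).

Definition tens_act (a : 'End(g)) (t : tensor_sq) : tensor_sq :=
  (a \o t \o transpose_end a)%VF.

Definition tens_dact (x : g) (t : tensor_sq) : tensor_sq :=
  ((ad x \o t) + (t \o transpose_end (ad x)))%VF.

Lemma tensE x y phi : tens x y phi = (phi y : C) *: x.
Proof.
pose f (psi : 'Hom(g, C^o)) := (psi y : C) *: x.
have f_lin : linear f.
  by move=> c psi1 psi2; rewrite /f !lfunE /= lfunE /= scalerDl scalerA.
pose F : {linear _ -> _} :=
  HB.pack f (GRing.isLinear.Build C _ _ _ f f_lin).
exact: (lfunE F).
Qed.

Lemma transpose_endE a phi : transpose_end a phi = (phi \o a)%VF.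
Proof.
pose f (psi : 'Hom(g, C^o)) := (psi \o a)%VF.
have f_lin : linear f.
  by move=> c psi1 psi2; rewrite /f comp_lfunDl comp_lfunZl.
pose F : {linear _ -> _} :=
  HB.pack f (GRing.isLinear.Build C _ _ _ f f_lin).
exact: (lfunE F).
Qed.

Lemma tens_act_tens a x y : tens_act a (tens x y) = tens (a x) (a y).
Proof.
apply/lfunP=> phi; rewrite /tens_act tensE.
rewrite (comp_lfunE (a \o _)%VF) comp_lfunE transpose_endE tensE.
by rewrite comp_lfunE linearZ.
Qed.

Lemma tens_dact_tens z x y :
  tens_dact z (tens x y) = tens (lie z x) y + tens x (lie z y).
Proof.
apply/lfunP=> phi; rewrite /tens_dact !add_lfunE !tensE.
rewrite (comp_lfunE (ad z)) (comp_lfunE (tens x y)) transpose_endE !tensE.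
by rewrite comp_lfunE linearZ /= !adE.
Qed.

Definition levi_tensor_z : {vspace tensor_sq} :=
  <<[seq tens x y | x <- vbasis levi_alg, y <- vbasis z_n]>>%VS.

Definition is_constituent (V : {vspace tensor_sq}) nu : Prop :=
  [/\ (V <= levi_tensor_z)%VS, levi_irreducible tens_act V &
      has_highest_weight tens_dact V nu].

Definition special_constituent mu gamma (V : {vspace tensor_sq}) nu : Prop :=
  [/\ is_constituent V nu, nu <> gamma &
      exists2 epsilon, epsilon \in roots_of g1 & nu = mu + epsilon].

Definition type_1a mu epsilon : Prop :=
  [/\ mu + epsilon \notin Delta, epsilon != mu,
      long_root mu & long_root epsilon].

End Roots.

Inductive dynkin :=
  | DynA of nat | DynB of nat | DynC of nat | DynD of nat
  | DynE6 | DynE7 | DynE8 | DynF4 | DynG2.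

Definition rank (T : dynkin) : nat :=
  match T with
  | DynA n | DynB n | DynC n | DynD n => n
  | DynE6 => 6 | DynE7 => 7 | DynE8 => 8 | DynF4 => 4 | DynG2 => 2
  end.

Definition joined (T : dynkin) (i j : nat) : bool :=
  let chain := (i == j.+1) || (j == i.+1) in
  let edge a b := ((i, j) == (a, b)) || ((i, j) == (b, a)) in
  match T with
  | DynA _ | DynB _ | DynC _ | DynF4 | DynG2 => chain
  | DynD n => [&& chain, i < n & j < n] || edge (n - 2) n
  | DynE6 | DynE7 | DynE8 =>
      [&& chain, 2 < i & 2 < j] || edge 1 3 || edge 2 4
  end%N.

(* Bourbaki's n(alpha_i, alpha_j) = 2 <alpha_i, alpha_j> / <alpha_j, alpha_j>,
   with 1-based i and j; the entry is below -1 when alpha_j is the shorter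
   root at a multiple edge. *)
Definition cartan_entry (T : dynkin) (i j : nat) : int :=
  if i == j then 2 else if ~~ joined T i j then 0 else
  match T with
  | DynB n => if (i, j) == (n.-1, n) then - 2%:Z else - 1%:Z
  | DynC n => if (i, j) == (n, n.-1) then - 2%:Z else - 1%:Z
  | DynF4 => if (i, j) == (2, 3)%N then - 2%:Z else - 1%:Z
  | DynG2 => if (i, j) == (2, 1)%N then - 3%:Z else - 1%:Z
  | _ => - 1%:Z
  end.

(* The ordinal j stands for Bourbaki's index j.+1. *)
Definition has_type (C : numFieldType) (g : lieAlgType C) (h : {vspace g})
    (T : dynkin) (Pi : (rank T).-tuple 'Hom(subvs_of h, C^o)) : Prop :=
  forall i j : 'I_(rank T),
    2 * root_form (tnth Pi i) (tnth Pi j) =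
    (cartan_entry T i.+1 j.+1)%:~R * root_form (tnth Pi j) (tnth Pi j).

(* [i] is the Bourbaki index. *)
Definition listed_type (T : dynkin) (i : nat) : bool :=
  match T with
  | DynB n => (3 <= i <= n)%N
  | DynC n => (2 <= i <= n - 1)%N
  | DynD n => (3 <= i <= n - 3)%N
  | DynE6 => (i == 3) || (i == 5)
  | DynE7 => (i == 2) || (i == 6)
  | DynE8 => i == 1
  | DynF4 => i == 4
  | DynA _ | DynG2 => false
  end%N.

(* Main.v *)
Require Import Defs.
From HB Require Import structures.
From mathcomp Require Import all_boot all_order all_algebra.
From mathcomp Require Import complex.
From mathcomp Require Import boolp classical_sets reals.
From mathcomp Require Import ring lra zify.

Set Implicit Arguments.
Unset Strict Implicit.
Unset Printing Implicit Defensive.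

Import Order.TTheory GRing.Theory Num.Theory.
Local Open Scope ring_scope.
Local Open Scope complex_scope.

(* Write L for the squared length of a long root. The Killing form is positive
   definite on real combinations of roots (trace formula in a basis of weight
   vectors), and the product rule for N alone makes Cartan numbers integers.
   Hence a long root pairs with any other root to at most L/2. Two pairs of
   roots with the same sum mu + epsilon, one of them long, therefore have all
   four mutual products equal to L/2 and are orthogonal; {gamma_j,
   theta gamma_j} is then a long pair too, and {alpha, theta alpha} is either
   long or twice the same short root.
     For a, b, c with a - b - c not a root, the Jacobi identity gives
       N(a,-b) N(b,-c) N(a-b,b-c) = L/2 N(a,-c).
   Apply it to (mu, alpha, gamma_j) and to (epsilon, theta alpha,
   theta gamma_j), and multiply: the third factors are N(u,v) and N(-u,-v), of
   product -L/2 in both cases for alpha. A last Jacobi identity rewrites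
   N(mu,-gamma_j) N(epsilon,-theta gamma_j) as the right-hand side.
     Finally alpha_q has squared length L because mu is long with
   alpha_q-coefficient 1. *)

Section SimultaneousEigenbasis.
Import VectorInternalTheory.
Variables (K : fieldType) (V : vectType K).

Lemma v2r_lfun (f : 'End(V)) v : v2r (f v) = v2r v *m f2mx f.
Proof. by rewrite unlock /= r2vK. Qed.

Lemma free_rows_r2v n (P : 'M[K]_(n, dim V)) :
  row_free P -> free [tuple r2v (row i P) | i < n].
Proof.
move=> Pfree; apply/freeP => k.
under eq_bigr => i _ do rewrite -tnth_nth tnth_mktuple -linearZ.
rewrite -linear_sum -[RHS](linear0 (@r2v K V)) => /r2v_inj kP0.
suff /rowP k0 : \row_i k i = 0 by move=> i; have := k0 i; rewrite !mxE.
apply: (row_free_inj Pfree); rewrite mul0mx mulmx_sum_row -[RHS]kP0.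
by apply: eq_bigr => i _; rewrite mxE.
Qed.

Lemma diagonalizable_f2mx (f : 'End(V)) (e : seq V) :
  basis_of fullv e -> (forall v, v \in e -> exists c : K, f v = c *: v) ->
  diagonalizable (f2mx f).
Proof.
move=> eb ef.
have es : size e == dim V by rewrite -(dimvf V) (size_basis (X := in_tuple e) eb).
pose t : (dim V).-tuple V := Tuple es.
pose P := \matrix_i v2r (tnth t i).
have Pu : P \in unitmx.
  rewrite -row_free_unit -kermx_eq0; apply/rowV0P => k /sub_kermxP kP0.
  have tfree : free t by exact: basis_free eb.
  apply/rowP => i; rewrite mxE; move/freeP: tfree => /(_ (k 0)); apply.
  apply: v2r_inj; rewrite linear0 linear_sum -[RHS]kP0 mulmx_sum_row.
  by apply: eq_bigr => j _; rewrite rowK -linearZ (tnth_nth 0).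
exists P => //; apply/diagonalizable_forPex.
have /fin_all_exists [d dE] (i : 'I_(dim V)) :
  exists c : K, f (tnth t i) = c *: tnth t i by apply: ef; exact: mem_tnth.
exists (\row_i d i); apply/simmxP => //; apply/row_matrixP => i.
by rewrite !row_mul rowK row_diag_mx -scalemxAl -rowE rowK mxE -v2r_lfun dE linearZ.
Qed.

Lemma common_eigenbasis (fs : seq 'End(V)) :
  (forall f1 f2, f1 \in fs -> f2 \in fs -> forall v, f1 (f2 v) = f2 (f1 v)) ->
  (forall f, f \in fs -> exists2 e : seq V, basis_of fullv e &
    forall v, v \in e -> exists c : K, f v = c *: v) ->
  exists2 e : (dim V).-tuple V, basis_of fullv e &
    forall f i, f \in fs -> exists c : K, f (tnth e i) = c *: tnth e i.
Proof.
move=> fC fD.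
have [|P Pu /allP PD] := (codiagonalizableP [seq f2mx f | f <- fs]).1.
  split=> [_ _ /mapP[f1 f1s ->] /mapP[f2 f2s ->]|_ /mapP[f fs_f ->]].
    apply/row_matrixP => i; rewrite !rowE.
    by rewrite -(r2vK (delta_mx 0 i)) !mulmxA -!v2r_lfun fC.
  by have [e eb ef] := fD f fs_f; apply: diagonalizable_f2mx eb ef.
exists [tuple r2v (row i P) | i < dim V].
  rewrite basisEfree subvf size_tuple dimvf leqnn !andbT.
  by apply: free_rows_r2v; rewrite row_free_unit.
move=> f i fs_f; have /diagonalizable_forPex[D /simmxP-/(_ Pu) PfD] :=
  PD _ (map_f f2mx fs_f).
exists (D 0 i); rewrite tnth_mktuple; apply: v2r_inj.
rewrite linearZ /= v2r_lfun r2vK -row_mul PfD row_mul row_diag_mx.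
by rewrite -scalemxAl -rowE.
Qed.

End SimultaneousEigenbasis.

Section Trace.
Variables (K : fieldType) (V : vectType K).
Implicit Types (f g : 'End(V)).

Definition basis_trace n (b : n.-tuple V) f : K := \sum_i coord b i (f b`_i).

Lemma basis_trace_comp n m (b : n.-tuple V) (e : m.-tuple V) f g :
  basis_of fullv b -> basis_of fullv e ->
  basis_trace b (f \o g)%VF = basis_trace e (g \o f)%VF.
Proof.
move=> bb eb; rewrite /basis_trace.
transitivity (\sum_(i < n) \sum_(j < m) coord e j (g b`_i) * coord b i (f e`_j)).
  apply: eq_bigr => i _; rewrite comp_lfunE.
  rewrite {1}(coord_basis eb (memvf (g b`_i))) !linear_sum.
  by apply: eq_bigr => j _; rewrite !linearZ.
rewrite exchange_big /=; apply: eq_bigr => j _; rewrite comp_lfunE.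
rewrite {2}(coord_basis bb (memvf (f e`_j))) !linear_sum.
by apply: eq_bigr => i _; rewrite !linearZ /= mulrC.
Qed.

Lemma basis_trace_indep n m (b : n.-tuple V) (e : m.-tuple V) f :
  basis_of fullv b -> basis_of fullv e -> basis_trace b f = basis_trace e f.
Proof.
move=> bb eb; rewrite -{1}[f]comp_lfun1r (basis_trace_comp _ _ bb eb).
by rewrite comp_lfun1l.
Qed.

End Trace.

Section Killing.
Variables (K : fieldType) (g : lieAlgType K).
Implicit Types (x y z : g).

Lemma lieDl y x1 x2 : lie (x1 + x2) y = lie x1 y + lie x2 y :> g.
Proof. by have := lie_linearl y 1 x1 x2; rewrite !scale1r. Qed.

Lemma lie0l y : lie 0 y = 0 :> g.
Proof. by apply: (addrI (lie 0 y)); rewrite -lieDl !addr0. Qed.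

Lemma lieZl c x y : lie (c *: x) y = c *: lie x y.
Proof. by have := lie_linearl y c x 0; rewrite /= lie0l !addr0. Qed.

Lemma lieC x y : lie x y = - lie y x.
Proof.
apply/eqP; rewrite -addr_eq0; apply/eqP.
by have := liexx (x + y); rewrite lieDl !linearD /= !liexx add0r addr0.
Qed.

Lemma lie_lie x y z : lie (lie x y) z = lie x (lie y z) - lie y (lie x z).
Proof.
have := lie_jacobi x y z; rewrite (lieC z (lie x y)) (lieC z x) linearN /=.
by move/eqP; rewrite subr_eq0 => /eqP ->.
Qed.

Lemma killing_trace n (e : n.-tuple g) x y :
  basis_of fullv e -> killing x y = basis_trace e (ad x \o ad y)%VF.
Proof. by move=> eb; rewrite -(basis_trace_indep _ (vbasisP fullv) eb). Qed.

Lemma killingC x y : killing x y = killing y x.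
Proof. exact: basis_trace_comp (vbasisP _) (vbasisP _). Qed.

Lemma killing_linear x : scalar (killing x).
Proof.
move=> c y z; rewrite /killing mulr_sumr -big_split; apply: eq_bigr => i _.
by rewrite !comp_lfunE !adE lieDl lieZl !linearD !linearZ.
Qed.

HB.instance Definition _ x := GRing.isSemilinear.Build K g K _ (killing x)
  (GRing.semilinear_linear (killing_linear x)).

Lemma killing_suml I (r : seq I) (F : I -> g) y :
  killing (\sum_(i <- r) F i) y = \sum_(i <- r) killing (F i) y.
Proof. by rewrite killingC linear_sum; apply: eq_bigr => i _; rewrite killingC. Qed.

Lemma killing_lie x y z : killing (lie x y) z = killing x (lie y z).
Proof.
pose b := vbasis {:g}; have bb : basis_of fullv b := vbasisP fullv.
have tr (u v : g) : killing u v = basis_trace b (ad u \o ad v)%VF by [].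
pose t3 (u v w : g) := basis_trace b (ad u \o (ad v \o ad w))%VF.
have t3C u v w : t3 u v w = t3 v w u.
  by rewrite /t3 (basis_trace_comp _ _ bb bb) comp_lfunA.
have -> : killing (lie x y) z = t3 x y z - t3 y x z.
  rewrite tr /t3 /basis_trace -sumrB; apply: eq_bigr => i _.
  by rewrite !comp_lfunE !adE lie_lie linearB.
have -> : killing x (lie y z) = t3 x y z - t3 x z y.
  rewrite tr /t3 /basis_trace -sumrB; apply: eq_bigr => i _.
  by rewrite !comp_lfunE !adE lie_lie !linearB.
by rewrite [t3 y x z]t3C.
Qed.

End Killing.

Section WeightBasis.
Variables (C : numFieldType) (g : lieAlgType C) (h : {vspace g}).
Local Notation hdual := 'Hom(subvs_of h, C^o).
Hypothesis h_cartan : cartan_subalgebra h.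

Lemma root_space_lie (a b : hdual) (x y : g) :
  x \in root_space a -> y \in root_space b -> lie x y \in root_space (a + b).
Proof.
move=> /root_spaceP xa /root_spaceP yb; apply/root_spaceP => H.
have := lie_lie (vsval H) x y; rewrite xa yb lieZl linearZ /= => /eqP.
rewrite eq_sym subr_eq => /eqP ->.
by rewrite add_lfunE scalerDl.
Qed.

Lemma weight_basis : exists (n : nat) (e : n.-tuple g) (w : 'I_n -> hdual),
  basis_of fullv e /\ forall i, tnth e i \in root_space (w i).
Proof.
have [hab _ hdiag] := h_cartan.
pose b := vbasis {:subvs_of h}.
have [f1 f2|f|e eb ew] := common_eigenbasis (fs := [seq ad (vsval H) | H <- b]).
- move=> /mapP[H1 _ ->] /mapP[H2 _ ->] v; rewrite !adE.
  have := lie_lie (vsval H1) (vsval H2) v.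
  rewrite (hab _ _ (subvsP H1) (subvsP H2)) lie0l => /esym/eqP.
  by rewrite subr_eq0 => /eqP.
- by move=> /mapP[H _ ->]; apply: hdiag; exact: subvsP.
have /fin_all_exists [c cE] (ij : 'I__ * 'I_(\dim {:subvs_of h})) :
    exists c : C, lie (vsval b`_ij.2) (tnth e ij.1) = c *: tnth e ij.1.
  have [|c cE] := ew (ad (vsval b`_ij.2)) ij.1.
    by apply/mapP; exists b`_ij.2 => //; rewrite mem_nth// size_tuple.
  by exists c; rewrite -cE adE.
pose bd j : hdual := linfun (coord b j : subvs_of h -> C^o).
have bdE j H : bd j H = coord b j H by rewrite lfunE.
exists _, e, (fun i => \sum_j (c (i, j)) *: bd j); split=> // i.
apply/root_spaceP => H; rewrite [in LHS](coord_vbasis (memvf H)) -/b.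
rewrite linear_sum /= sum_lfunE scaler_suml.
rewrite (big_morph (fun u : g => lie u (tnth e i)) (lieDl _) (lie0l _)).
apply: eq_bigr => j _.
by rewrite lieZl (cE (i, j)) scale_lfunE bdE scalerA mulrC.
Qed.

End WeightBasis.

Section RootSystem.
Variables (C : numFieldType) (g : lieAlgType C) (h : {vspace g}).
Local Notation hdual := 'Hom(subvs_of h, C^o).
Variables (Delta : seq hdual) (X : hdual -> g) (Hc : hdual -> subvs_of h).
Variable N : hdual -> hdual -> C.
Hypothesis h_cartan : cartan_subalgebra h.
Hypothesis DeltaP : enumerates_roots Delta.
Hypothesis normX : root_normalization Delta X Hc N.
Implicit Types (a b c lambda nu : hdual) (H : subvs_of h) (x y : g).

Lemma root_space_nonroot a x :
  a != 0 -> a \notin Delta -> x \in root_space a -> x = 0.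
Proof.
rewrite DeltaP /is_root => -> /=; rewrite negbK => /eqP ->.
by rewrite memv0 => /eqP.
Qed.

Lemma root_neq0 a : a \in Delta -> a != 0.
Proof. by rewrite DeltaP => /andP[]. Qed.

Lemma weight_root a x :
  x \in root_space a -> x != 0 -> a != 0 -> a \in Delta.
Proof.
move=> xa x0 a0; apply: contraNT x0 => aD.
by rewrite (root_space_nonroot a0 aD xa).
Qed.

Lemma killing_root_space a b x y : x \in root_space a -> y \in root_space b ->
  killing x y != 0 -> a + b = 0.
Proof.
move=> /root_spaceP xa /root_spaceP yb kxy; apply/lfunP => H.
apply: (mulIf kxy); rewrite add_lfunE lfunE /= mul0r mulrDl.
have := killing_lie x (vsval H) y; rewrite lieC xa yb -scaleNr !linearZ /=.
by rewrite killingC linearZ /= killingC mulNr => <-; rewrite addrN.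
Qed.

Lemma rootN a : a \in Delta -> - a \in Delta.
Proof.
move=> aD; have [n [e [w [eb ew]]]] := weight_basis h_cartan.
have := rn_killing normX aD.
rewrite (coord_basis eb (memvf (X (- a)))) linear_sum /= => k1.
have [i ki] : exists i, killing (X a) (tnth e i) != 0.
  apply: contrapT => /forallNP k0; have /eqP[] := oner_neq0 C.
  rewrite -[LHS]k1; apply: big1 => i _; rewrite linearZ /= -tnth_nth.
  by have /negP := k0 i; rewrite negbK => /eqP ->; rewrite mulr0.
have := killing_root_space (rn_root_vector normX aD) (ew i) ki.
move/eqP; rewrite addrC addr_eq0 => /eqP wi.
rewrite -wi; apply: weight_root (ew i) _ _; last by rewrite wi oppr_eq0 root_neq0.
by apply: contraNneq ki => ->; rewrite linear0.
Qed.

Lemma rootNE a : (- a \in Delta) = (a \in Delta).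
Proof. by apply/idP/idP => /rootN; rewrite ?opprK. Qed.

Lemma root_vector_neq0 a : a \in Delta -> X a != 0.
Proof.
move=> aD; apply/eqP => Xa0; have := rn_killing normX aD.
by rewrite Xa0 killingC linear0 => /esym/eqP; rewrite oner_eq0.
Qed.

Definition represents (t : subvs_of h) lambda :=
  forall H, killing (vsval t) (vsval H) = lambda H.

Lemma represents_Hc a : a \in Delta -> represents (Hc a) a.
Proof.
move=> aD H; rewrite -(rn_coroot normX aD) killing_lie.
have /root_spaceP Xa := rn_root_vector normX (rootN aD).
rewrite lieC Xa -scaleNr linearZ /= (rn_killing normX aD) mulr1.
by rewrite opp_lfunE opprK.
Qed.

Variables (n : nat) (Pi : n.-tuple hdual).
Hypothesis Pi_simple : simple_system Delta Pi.

Lemma representsP lambda : represents (killing_repr lambda) lambda.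
Proof.
apply: (@xgetPex _ 0 [set t | represents t lambda]%classic).
have [PiD Pib _] := Pi_simple.
exists (\sum_j coord Pi j lambda *: Hc Pi`_j) => H /=.
rewrite [RHS](congr1 (fun f : hdual => f H) (coord_basis Pib (memvf lambda))).
rewrite sum_lfunE linear_sum /= killing_suml; apply: eq_bigr => j _.
rewrite killingC linearZ /= killingC represents_Hc ?scale_lfunE//.
by apply: PiD; rewrite mem_nth// size_tuple.
Qed.

Local Notation form := (@root_form C g h).

Lemma root_formE lambda nu : form lambda nu = lambda (killing_repr nu).
Proof. exact: representsP. Qed.

Lemma root_formC lambda nu : form lambda nu = form nu lambda.
Proof. exact: killingC. Qed.

Lemma root_formDl a b c : form (a + b) c = form a c + form b c.
Proof. by rewrite !root_formE add_lfunE. Qed.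

Lemma root_formNl a b : form (- a) b = - form a b.
Proof. by rewrite !root_formE opp_lfunE. Qed.

Lemma root_form0l a : form 0 a = 0.
Proof. by rewrite root_formE lfunE. Qed.

Lemma root_formNr a b : form a (- b) = - form a b.
Proof. by rewrite root_formC root_formNl root_formC. Qed.

Lemma eval_Hc a b : a \in Delta -> b \in Delta -> b (Hc a) = form a b.
Proof. by move=> aD bD; rewrite (rn_eval normX aD bD). Qed.

Lemma root_form_weights : exists ws : seq hdual,
  {subset ws <= 0 :: Delta} /\
  (forall lambda nu, form lambda nu = \sum_(w <- ws) form lambda w * form w nu)
  /\ forall lambda, {in ws, forall w, form lambda w = 0} -> lambda = 0.
Proof.
have [m [e [w [eb ew]]]] := weight_basis h_cartan.
have kE H1 H2 : killing (vsval H1) (vsval H2) = \sum_i w i H1 * w i H2.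
  rewrite (killing_trace _ _ eb); apply: eq_bigr => i _.
  have /root_spaceP wi := ew i.
  rewrite comp_lfunE !adE -tnth_nth wi linearZ /= wi scalerA linearZ /=.
  by rewrite (tnth_nth 0) coord_free ?(basis_free eb)// eqxx mulr1 mulrC.
exists [seq w i | i <- enum 'I_m]; split=> [_ /mapP[i _ ->]|].
  rewrite inE; have [//|wi0 /=] := eqVneq; apply: weight_root (ew i) _ wi0.
  by apply: (basis_not0 eb); exact: mem_tnth.
split=> [lambda nu|lambda l0].
  rewrite /root_form kE big_map big_enum /=; apply: eq_bigr => i _.
  by rewrite -!root_formE root_formC.
apply/lfunP => H; rewrite -representsP kE lfunE /= big1// => i _.
by rewrite -root_formE root_formC l0 ?mul0r// map_f// mem_enum.
Qed.


Lemma string_endP a b : a != 0 -> b \in Delta -> exists q, string_end Delta a b q.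
Proof.
move=> a0 bD; pose P j := b + a *+ j \in Delta.
have P0 : exists j, P j by exists 0%N; rewrite /P addr0.
have inj_str j k : b + a *+ j = b + a *+ k -> j = k.
  move/addrI; rewrite -!scaler_nat => /eqP; rewrite -subr_eq0 -scalerBl.
  by rewrite scaler_eq0 (negPf a0) orbF subr_eq0 eqr_nat => /eqP.
pose idx d : nat := xget 0%N [set j | d = b + a *+ j]%classic.
have Pb j : P j -> (j <= \max_(d <- Delta) idx d)%N.
  move=> Pj; suff {1}-> : j = idx (b + a *+ j) by exact: leq_bigmax_seq.
  by rewrite /idx; case: xgetP => [_ _ /inj_str//|/(_ j)/(_ erefl)].
exists (ex_maxn P0 Pb); case: ex_maxnP => q Pq qmax; split=> //.
Qed.

Lemma struct_antisym a b : a \in Delta -> b \in Delta -> a + b \in Delta ->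
  N a b = - N b a.
Proof.
move=> aD bD abD; apply/eqP; rewrite -addr_eq0.
have := lieC (X a) (X b); rewrite (rn_bracket normX) //.
rewrite (rn_bracket normX) 1?[b + a]addrC// => /eqP; rewrite -addr_eq0 -scalerDl.
by rewrite scaler_eq0 (negPf (root_vector_neq0 abD)) orbF.
Qed.

Lemma lie_root_vector0 a b : a \in Delta -> b \in Delta -> a + b != 0 ->
  a + b \notin Delta -> lie (X a) (X b) = 0.
Proof.
move=> aD bD ab0 abD; apply: (root_space_nonroot ab0 abD).
by apply: root_space_lie; exact: (rn_root_vector normX).
Qed.

Definition down_coef a b (p q : nat) : C :=
  if b - a \in Delta then (p * (1 + q))%:R / 2 * form a a else 0.

Lemma lie_down a b p q : a \in Delta -> b \in Delta -> a != b ->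
  string_end Delta (- a) b p -> string_end Delta a b q ->
  lie (X a) (lie (X (- a)) (X b)) = down_coef a b p q *: X b.
Proof.
move=> aD bD ab sp sq; rewrite /down_coef.
have NaD := rootN aD; have NbD := rootN bD.
case: ifP => baD; last first.
  have baE : - a + b = b - a by rewrite addrC.
  rewrite (@lie_root_vector0 (- a) b) ?baE ?baD ?subr_eq0 1?eq_sym//.
  by rewrite linear0 scale0r.
have NbaD : - a + b \in Delta by rewrite addrC.
rewrite (rn_bracket normX) // linearZ /= (rn_bracket normX) //; last first.
  by rewrite addrA subrr add0r.
have -> : a + (- a + b) = b by rewrite addrA subrr add0r.
rewrite scalerA; congr (_ *: _).
have [|E1 E2] := rn_cyclic normX aD NbaD NbD; first by rewrite addrA subrr add0r subrr.
rewrite E1 E2 (@struct_antisym (- b) a)// ?mulrN; last first.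
  by rewrite addrC -opprB rootNE.
have := rn_product normX NaD bD NbaD; rewrite opprK => /(_ q p sq sp) ->.
by rewrite opprK root_formNl root_formNr opprK.
Qed.

Lemma root_form_string a b p q : a \in Delta -> b \in Delta -> a != b -> - a != b ->
  string_end Delta (- a) b p -> string_end Delta a b q ->
  form a b = down_coef a b p q - down_coef (- a) b q p.
Proof.
move=> aD bD ab Nab sp sq.
have := lie_lie (X a) (X (- a)) (X b).
rewrite (rn_coroot normX)//; have /root_spaceP -> := rn_root_vector normX bD.
rewrite eval_Hc// (lie_down aD bD ab sp sq).
have := @lie_down (- a) b q p (rootN aD) bD Nab; rewrite opprK => /(_ sq sp) ->.
rewrite -scalerBl => /eqP; rewrite -subr_eq0 -scalerBl scaler_eq0.
by rewrite (negPf (root_vector_neq0 bD)) orbF subr_eq0 => /eqP.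
Qed.

Lemma cartan_integer a b : a \in Delta -> b \in Delta -> a != b -> - a != b ->
  exists z : int, 2 * form a b = z%:~R * form a a /\ (0 < z -> b - a \in Delta).
Proof.
move=> aD bD ab Nab.
have [p sp] := string_endP (root_neq0 (rootN aD)) bD.
have [q sq] := string_endP (root_neq0 aD) bD.
rewrite (root_form_string aD bD ab Nab sp sq) /down_coef opprK.
have half2 (m : nat) : 2 * (m%:R / 2 * form a a) = m%:R * form a a.
  by rewrite mulrA mulrCA divff ?mulr1// pnatr_eq0.
exists ((if b - a \in Delta then (p * (1 + q))%:Z else 0) -
        (if b + a \in Delta then (q * (1 + p))%:Z else 0)); split.
  rewrite rmorphB mulrBl mulrBr root_formNl root_formNr opprK.
  by do 2!case: ifP => _; rewrite ?half2 ?mulr0 ?mul0r ?pmulrn.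
case: ifP => // _; rewrite sub0r oppr_gt0; case: ifP => _; last by rewrite ltxx.
by rewrite ltNge.
Qed.

(* If no [b + j a] with [j > 0] is a root, the root string is [b, ..., b - p a]
   with [p] its Cartan integer, so [b - p a] is the reflection of [b] in [a]. *)
Lemma reflection_string_top a b : a \in Delta -> b \in Delta ->
  a != b -> - a != b -> (forall j, (0 < j)%N -> b + a *+ j \notin Delta) ->
  exists p : nat, 2 * form a b = p%:R * form a a /\ b - a *+ p \in Delta.
Proof.
move=> aD bD ab Nab top.
have [p sp] := string_endP (root_neq0 (rootN aD)) bD.
have sq : string_end Delta a b 0.
  split=> [|[//|j]]; first by rewrite addr0.
  by move=> bj; have := top j.+1 isT; rewrite bj.
rewrite (root_form_string aD bD ab Nab sp sq) /down_coef opprK.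
have half2 (m : nat) : 2 * (m%:R / 2 * form a a) = m%:R * form a a.
  by rewrite mulrA mulrCA divff ?mulr1// pnatr_eq0.
have /negPf -> : b + a \notin Delta by have := top 1%N isT.
have [baD|_] := ifP; last by exists 0%N; rewrite subr0 mulr0 mul0r subr0.
exists p; rewrite subr0 half2 addn0 muln1; split=> //.
by have [] := sp; rewrite mulNrn.
Qed.

Lemma root_form_self_cartan a b : a \in Delta -> b \in 0 :: Delta ->
  exists z : int, 2 * form a b = z%:~R * form a a.
Proof.
move=> aD; rewrite inE => /predU1P[->|bD].
  by exists 0; rewrite root_formC root_form0l mulr0 mul0r.
have [<-|ab] := eqVneq a b; first by exists 2.
have [<-|Nab] := eqVneq (- a) b.
  by exists (- 2%:Z); rewrite root_formNr mulrN mulrNz mulNr.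
by have [z []] := cartan_integer aD bD ab Nab; exists z.
Qed.

Lemma root_form_self_gt0 a : a \in Delta -> 0 < form a a.
Proof.
move=> aD; have [ws [wD [fE f0]]] := root_form_weights.
have [|z zE] := @choice _ _ (fun w (z : int) => w \in ws ->
    2 * form a w = z%:~R * form a a).
  move=> w; have [wws|wws] := boolP (w \in ws); last by exists 0.
  by have [z zE] := root_form_self_cartan aD (wD w wws); exists z.
have c0 : form a a != 0.
  apply: contraNneq (root_neq0 aD) => c0; apply/eqP/f0 => w wws.
  by apply/eqP; have /eqP := zE w wws; rewrite c0 mulr0 mulf_eq0 pnatr_eq0.
pose s : C := \sum_(w <- ws) (z w)%:~R ^+ 2.
have sE : 4 * form a a = form a a * (form a a * s).
  rewrite [X in 4 * X]fE !mulr_sumr big_seq [RHS]big_seq; apply: eq_bigr => w wws.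
  rewrite (root_formC w a); have := zE w wws; move: (form a w) (z w) => u k ku.
  by transitivity ((2 * u) ^+ 2); [ring|rewrite ku; ring].
have fs : form a a * s = 4.
  by apply: (mulfI c0); rewrite -sE mulrC.
have s_ge0 : 0 <= s by apply: sumr_ge0 => w _; rewrite -realEsqr realz.
have s0 : s != 0 by apply: contra_eq_neq fs => ->; rewrite mulr0 eq_sym pnatr_eq0.
by rewrite -(pmulr_lgt0 _ (_ : 0 < s)) ?fs ?ltr0n// lt_def s0.
Qed.


Lemma struct_triangle a b c d : a \in Delta -> b \in Delta -> c \in Delta ->
  a - b \in Delta -> b - c \in Delta -> a - c \in Delta ->
  a - b - c \notin Delta -> a - b - c != 0 -> N a (- b) * N (- a) b = - d ->
  N a (- b) * N b (- c) * N (a - b) (b - c) = d * N a (- c).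
Proof.
move=> aD bD cD abD bcD acD abcD abc0 Nd.
have NcD := rootN cD; have NaD := rootN aD.
have abK : a - b + b = a by rewrite subrK.
have := lie_lie (X (a - b)) (X b) (X (- c)).
rewrite (@lie_root_vector0 (a - b) (- c))// linear0 subr0.
rewrite (rn_bracket normX abD bD) ?abK// (rn_bracket normX bD NcD)//.
rewrite lieZl linearZ /= (rn_bracket normX aD NcD)//.
rewrite (rn_bracket normX abD bcD) addrA subrK// !scalerA => /eqP.
rewrite -subr_eq0 -scalerBl scaler_eq0 (negPf (root_vector_neq0 acD)) orbF subr_eq0.
have [|-> _] := rn_cyclic normX abD bD NaD; first by rewrite subrK subrr.
rewrite (struct_antisym bD NaD) -1?[b - a]opprB ?rootNE ?opprB// => /eqP E.
by rewrite -mulrA -E mulrA mulrN Nd opprK.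
Qed.

Lemma struct_swap a b c d : a \in Delta -> b \in Delta -> c \in Delta -> d \in Delta ->
  a + b = c + d -> a + b != 0 -> a + b \notin Delta ->
  a - c \in Delta -> b - c \in Delta -> a - d \in Delta -> b - d \in Delta ->
  N a (b - c) * N b (- c) = - (N a (- c) * N b (- d)).
Proof.
move=> aD bD cD dD abcd ab0 abD acD bcD adD bdD.
have NcD := rootN cD; have NdD := rootN dD.
have dE : a + b - c = d by rewrite abcd addrC addKr.
have := lie_lie (X a) (X b) (X (- c)); rewrite lie_root_vector0// lie0l.
rewrite (rn_bracket normX bD NcD)// (rn_bracket normX aD NcD)// !linearZ /=.
rewrite (rn_bracket normX aD bcD) addrA dE// (rn_bracket normX bD acD).
  rewrite addrA (addrC b a) dE scalerN !scalerA -scalerBl => /esym/eqP.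
  rewrite scaler_eq0 (negPf (root_vector_neq0 dD)) orbF subr_eq0 mulrC => /eqP ->.
  have [|-> ->] := rn_cyclic normX bD acD NdD.
    by rewrite addrA (addrC b a) dE subrr.
  by rewrite (struct_antisym NdD bD) ?mulrN// addrC.
by rewrite addrA (addrC b a) dE.
Qed.

End RootSystem.

Section LongRoots.
Variables (R : realFieldType) (V : zmodType) (Delta : seq V) (B : V -> V -> R).
Implicit Types a b m e x y : V.
Hypothesis BC : forall a b, B a b = B b a.
Hypothesis BDl : forall a b c, B (a + b) c = B a c + B b c.
Hypothesis BNl : forall a b, B (- a) b = - B a b.
Hypothesis B_gt0 : forall a, a \in Delta -> 0 < B a a.
Hypothesis B_separates : forall a b, a \in Delta -> b \in Delta ->
  B (a - b) (a - b) <= 0 -> a = b.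
Hypothesis B_integral : forall a b, a \in Delta -> b \in Delta ->
  exists z : int, 2 * B a b = z%:~R * B a a.
Hypothesis B_sub_root : forall a b, a \in Delta -> b \in Delta ->
  0 < B a b -> a != b -> b - a \in Delta.
Hypothesis DeltaN : forall a, a \in Delta -> - a \in Delta.

Definition is_long m := m \in Delta /\ forall b, b \in Delta -> B b b <= B m m.

Lemma symform_Dr a b c : B c (a + b) = B c a + B c b.
Proof. by rewrite !(BC c) BDl. Qed.

Lemma symform_Nr a b : B b (- a) = - B b a.
Proof. by rewrite !(BC b) BNl. Qed.

Lemma symform_0l a : B 0 a = 0.
Proof. by have := BDl 0 0 a; rewrite addr0; lra. Qed.

Lemma symform_0r a : B a 0 = 0.
Proof. by rewrite BC symform_0l. Qed.

Lemma symform_Mnr a b n : B a (b *+ n) = n%:R * B a b.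
Proof.
elim: n => [|n IH]; rewrite ?symform_0r ?mul0r//.
by rewrite mulrS symform_Dr IH mulrS mulrDl mul1r.
Qed.

Lemma symform_Mnl a b n : B (b *+ n) a = n%:R * B b a.
Proof. by rewrite BC symform_Mnr BC. Qed.

Lemma norm_addMn a b j :
  B (a + b *+ j) (a + b *+ j) = B a a + 2 * (j%:R * B b a) + j%:R * (j%:R * B b b).
Proof. by rewrite BDl !symform_Dr !symform_Mnl !symform_Mnr (BC a b); ring. Qed.

Lemma norm_string_down L u v j : 0 < L -> B u u = L -> 0 < B v v ->
  B u v = L / 2 -> (0 < j)%N -> L < B (v + u *+ j) (v + u *+ j).
Proof.
move=> L0 uu v0 uv j0; have jR : 1 <= j%:R :> R by rewrite ler1n.
have h1 : 0 <= (j%:R - 1) * L by rewrite mulr_ge0//; lra.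
have h2 : 0 <= j%:R * (j%:R * L) by rewrite !mulr_ge0// ltW.
by rewrite norm_addMn uu uv; lra.
Qed.

Lemma norm_string_up L u v j : 0 < L -> B u u = L -> 0 < B v v ->
  B u v = - (L / 2) -> (1 < j)%N -> L < B (v + u *+ j) (v + u *+ j).
Proof.
move=> L0 uu v0 uv j1; have jR : 2 <= j%:R :> R by rewrite ler_nat.
have : 0 <= (j%:R - 2) * (j%:R + 1) * L by rewrite !mulr_ge0//; lra.
by rewrite norm_addMn uu uv; lra.
Qed.

Lemma norm_string_orthogonal L u v j : 0 < L -> B u u = L / 2 ->
  B v v = L / 2 -> B u v = 0 -> (1 < j)%N -> L < B (v + u *+ j) (v + u *+ j).
Proof.
move=> L0 uu vv uv j1; have jR : 2 <= j%:R :> R by rewrite ler_nat.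
have : 0 <= (j%:R - 2) * (j%:R + 2) * L by rewrite !mulr_ge0//; lra.
by rewrite norm_addMn uu vv uv; lra.
Qed.

Lemma norm_sub a b : B a b = B a a / 2 -> B (a - b) (a - b) = B b b.
Proof. by rewrite BDl !symform_Dr !BNl !symform_Nr (BC b a); lra. Qed.

Lemma norm_subC a b : B (a - b) (a - b) = B (b - a) (b - a).
Proof. by rewrite !BDl !symform_Dr !BNl !symform_Nr (BC b a); lra. Qed.

Lemma norm_subr a b : B b a = B b b / 2 -> B (a - b) (a - b) = B a a.
Proof. by move=> /norm_sub; rewrite norm_subC. Qed.

Lemma norm_sub_sub m x c : 0 < B x x -> B c c = B m m -> B m x = B m m / 2 ->
  B m c = B m m / 2 -> B c x = B c c / 2 -> B m m < B (m - x - c) (m - x - c).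
Proof.
move=> x0 cc mx mc cx; rewrite !BDl !symform_Dr !BNl !symform_Nr.
by rewrite (BC x m) (BC c m) (BC x c); lra.
Qed.

Lemma form_sub_sub m x c : B c c = B m m -> B m x = B m m / 2 ->
  B m c = B m m / 2 -> B c x = B c c / 2 ->
  B (m - x) (x - c) = B m m / 2 - B x x.
Proof.
by move=> cc mx mc cx; rewrite !BDl !symform_Dr !BNl !symform_Nr (BC x c); lra.
Qed.

Lemma is_long_eq m e : is_long m -> is_long e -> B m m = B e e.
Proof.
by move=> [mD lm] [eD le]; apply/eqP; rewrite eq_le lm// le.
Qed.

Lemma long_le_half m b : is_long m -> b \in Delta -> b != m ->
  B m b <= B m m / 2.
Proof.
move=> [mD ml] bD bm; have [z zE] := B_integral mD bD.
have m0 := B_gt0 mD; have bl := ml _ bD.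
have [z1|z2] := lerP z 1.
  have : z%:~R * B m m <= 1 * B m m by rewrite ler_pM2r// (ler_int _ z 1).
  by rewrite -zE; lra.
have : 2 * B m m <= z%:~R * B m m by rewrite ler_pM2r// (ler_int _ 2 z).
rewrite -zE => h; case/eqP: bm; apply: B_separates => //.
by rewrite BDl !symform_Dr !BNl !symform_Nr (BC b m); lra.
Qed.

Section Pair.
Variables m e x y : V.
Hypotheses (ml : is_long m) (el : is_long e) (me : 0 <= B m e).
Hypotheses (xD : x \in Delta) (yD : y \in Delta) (xy : x + y = m + e).
Hypotheses (xm : x != m) (xe : x != e).

Let L : R := B m m.

Let ym : y != m.
Proof.
apply: contraNneq xe => ym.
by apply/eqP/(addIr m); rewrite [e + m]addrC -xy ym.
Qed.

Let ye : y != e.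
Proof. by apply: contraNneq xm => ye; apply/eqP/(addIr e); rewrite -xy ye. Qed.

Lemma long_pair :
  [/\ B m e = 0, B m x = L / 2 /\ B e x = L / 2, B m y = L / 2 /\ B e y = L / 2,
      B x x + B x y = L & B y y + B x y = L].
Proof.
have Le : B e e = L := esym (is_long_eq ml el).
have h1 := long_le_half ml xD xm; have h2 := long_le_half el xD xe.
have h3 := long_le_half ml yD ym; have h4 := long_le_half el yD ye.
have E u : B u x + B u y = B u m + B u e by rewrite -!symform_Dr xy.
have := E m; have := E e; have := E x; have := E y.
rewrite (BC y x) (BC x m) (BC x e) (BC y m) (BC y e) (BC e m).
move: h1 h2 h3 h4 Le me; rewrite -/L.
by move=> *; split; [|split|split| |]; lra.
Qed.

Lemma long_pair_lengths :
  (B x x = L /\ B x y = 0) \/ (x = y /\ 2 * B x x = L).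
Proof.
have [_ [mx _] _ xxy yxy] := long_pair.
have [mD _] := ml; have L0 : 0 < L := B_gt0 mD.
have x0 := B_gt0 xD.
have [z zE] := B_integral xD mD.
have {}zE : L = z%:~R * B x x by rewrite -zE BC mx; lra.
have z_gt0 : 0 < z.
  by rewrite -(ltr0z R) -(pmulr_lgt0 _ x0) -zE.
have [z1|z1] := eqVneq z 1; first by left; move: zE; rewrite z1 mul1r => zE; split; lra.
have z2 : 2 <= z by lia.
have h : 2 * B x x <= L by rewrite zE ler_pM2r// (ler_int _ 2 z).
right; have xy' : x = y.
  apply: B_separates => //.
  by rewrite BDl !symform_Dr !BNl !symform_Nr (BC y x); lra.
by split=> //; move: xxy; rewrite -xy'; lra.
Qed.

End Pair.

Lemma nonroot_of_long m b : is_long m -> B m m < B b b -> b \notin Delta.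
Proof. by move=> [_ ml]; apply: contraTN => /ml; rewrite -leNgt. Qed.

Lemma long_nonsum_ge0 m e : is_long m -> is_long e -> m + e \notin Delta ->
  m + e != 0 -> 0 <= B m e.
Proof.
move=> [mD _] [eD _] meD me0; rewrite leNgt; apply: contra meD => Bme.
rewrite addrC -[m]opprK; apply: B_sub_root => //; first exact: DeltaN.
  by rewrite BNl oppr_gt0.
by apply: contraNneq me0 => <-; rewrite addrN.
Qed.

End LongRoots.

Section RealRootForm.
Variables (R : realType) (g : lieAlgType R[i]) (h : {vspace g}).
Local Notation C := (R[i]).
Local Notation hdual := 'Hom(subvs_of h, C^o).
Variables (Delta : seq hdual) (X : hdual -> g) (Hc : hdual -> subvs_of h).
Variable N : hdual -> hdual -> C.
Variables (n : nat) (Pi : n.-tuple hdual).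
Hypothesis h_cartan : cartan_subalgebra h.
Hypothesis DeltaP : enumerates_roots Delta.
Hypothesis normX : root_normalization Delta X Hc N.
Hypothesis Pi_simple : simple_system Delta Pi.
Implicit Types a b c m e : hdual.

Local Notation form := (@root_form C g h).

Definition re_form a b : R := complex.Re (form a b).

Let ReD (u v : C) : complex.Re (u + v) = complex.Re u + complex.Re v.
Proof. by case: u v => [? ?] []. Qed.

Let ReN (u : C) : complex.Re (- u) = - complex.Re u.
Proof. by case: u. Qed.

Lemma re_formC a b : re_form a b = re_form b a.
Proof. by rewrite /re_form root_formC. Qed.

Lemma re_formDl a b c : re_form (a + b) c = re_form a c + re_form b c.
Proof. by rewrite /re_form (root_formDl h_cartan DeltaP normX Pi_simple) ReD. Qed.

Lemma re_formNl a b : re_form (- a) b = - re_form a b.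
Proof. by rewrite /re_form (root_formNl h_cartan DeltaP normX Pi_simple) ReN. Qed.

Lemma root_form_self_re a : a \in Delta -> form a a = (re_form a a)%:C.
Proof.
move=> /(root_form_self_gt0 h_cartan DeltaP normX Pi_simple).
rewrite /re_form ltcE /=; case: (form a a) => u v /= /andP[/eqP -> _].
by [].
Qed.

Lemma re_form_gt0 a : a \in Delta -> 0 < re_form a a.
Proof.
move=> /(root_form_self_gt0 h_cartan DeltaP normX Pi_simple).
by rewrite ltcE /= => /andP[].
Qed.

Lemma root_form_re a b : a \in Delta -> b \in 0 :: Delta ->
  form a b = (re_form a b)%:C.
Proof.
move=> aD bD.
have [z zE] := root_form_self_cartan h_cartan DeltaP normX Pi_simple aD bD.
suff fE : form a b = (z%:~R / 2 * re_form a a)%:C by rewrite /re_form fE.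
apply: (mulfI (_ : 2 != 0 :> C)); first by rewrite pnatr_eq0.
rewrite zE (root_form_self_re aD) !rmorphM fmorphV rmorph_int rmorph_nat /=.
by rewrite mulrA mulrCA divff ?mulr1// pnatr_eq0.
Qed.

Lemma re_form_integral a b : a \in Delta -> b \in Delta ->
  exists z : int, 2 * re_form a b = z%:~R * re_form a a.
Proof.
move=> aD bD; have b0D : b \in 0 :: Delta by rewrite inE bD orbT.
have [z zE] := root_form_self_cartan h_cartan DeltaP normX Pi_simple aD b0D.
exists z; apply: (@complexI R); rewrite !rmorphM rmorph_int rmorph_nat /=.
by rewrite -root_form_re// -root_form_self_re.
Qed.

Lemma re_form_sub_root a b : a \in Delta -> b \in Delta ->
  0 < re_form a b -> a != b -> b - a \in Delta.
Proof.
move=> aD bD ab_gt0 ab; have [Nab|Nab] := eqVneq (- a) b.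
  move: ab_gt0; rewrite -Nab re_formC re_formNl oppr_gt0 ltNge.
  by rewrite ltW// re_form_gt0.
have [z [zE]] := cartan_integer h_cartan DeltaP normX Pi_simple aD bD ab Nab.
apply; have a_gt0 := re_form_gt0 aD.
rewrite -(ltr0z R) -(pmulr_lgt0 _ a_gt0).
suff <- : 2 * re_form a b = z%:~R * re_form a a by rewrite pmulr_rgt0.
apply: (@complexI R); rewrite !rmorphM rmorph_int rmorph_nat /=.
by rewrite -root_form_re ?inE ?bD ?orbT// -root_form_self_re.
Qed.

Lemma re_form_separates a b : a \in Delta -> b \in Delta ->
  re_form (a - b) (a - b) <= 0 -> a = b.
Proof.
move=> aD bD.
have [ws [wD [fE f0]]] := root_form_weights h_cartan DeltaP normX Pi_simple.
have wE w : w \in ws -> form (a - b) w = (re_form (a - b) w)%:C.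
  move=> /wD w0D; rewrite (root_formDl h_cartan DeltaP normX Pi_simple).
  rewrite (root_formNl h_cartan DeltaP normX Pi_simple).
  by rewrite (root_form_re aD w0D) (root_form_re bD w0D) -rmorphB re_formDl re_formNl.
have -> : re_form (a - b) (a - b) = \sum_(w <- ws) re_form (a - b) w ^+ 2.
  apply: (@complexI R); rewrite rmorph_sum.
  have -> : (re_form (a - b) (a - b))%:C = form (a - b) (a - b).
    rewrite /re_form fE; under eq_big_seq => w wws do
      rewrite (root_formC w) (wE w wws) -rmorphM.
    by rewrite -rmorph_sum.
  rewrite fE; apply: eq_big_seq => w wws.
  by rewrite (root_formC w) (wE w wws) -rmorphM.
move=> le0; apply/eqP; rewrite -subr_eq0; apply/eqP/f0 => w wws.
have ge0 i : true -> 0 <= re_form (a - b) i ^+ 2 by rewrite sqr_ge0.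
have : \sum_(w <- ws) re_form (a - b) w ^+ 2 == 0.
  by rewrite eq_le le0 sumr_ge0.
rewrite psumr_eq0// => /allP/(_ w wws); rewrite /= sqrf_eq0 => /eqP.
by rewrite wE// => ->.
Qed.

Lemma long_root_re m : long_root Delta m -> is_long Delta re_form m.
Proof. by move=> [mD lm]; split=> // b /lm; rewrite lecE => /andP[]. Qed.

Section AlphaQ.
Variable iq : 'I_n.
Local Notation aq := (alpha_q Pi iq).

Let coordPi i j : coord Pi j (tnth Pi i) = (i == j)%:R.
Proof.
have [_ Pib _] := Pi_simple.
by rewrite (tnth_nth 0) coord_free// (basis_free Pib).
Qed.

Lemma simple_rootD i : tnth Pi i \in Delta.
Proof. by have [PiD _ _] := Pi_simple; apply: PiD; exact: mem_tnth. Qed.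

(* Reflecting [b] in simple roots other than [alpha_q] lowers its height and
   keeps both its length and its coefficient 1; when no such reflection applies,
   [B b b <= B b alpha_q], which for a long [b] forces [b = alpha_q]. *)
Lemma alpha_q_is_long m : is_long Delta re_form m -> coord Pi iq m = 1 ->
  re_form aq aq = re_form m m.
Proof.
have [PiD Pib Pic] := Pi_simple.
have coordE (c : 'I_n -> nat) j : coord Pi j (\sum_i tnth Pi i *+ c i) = (c j)%:R.
  under eq_bigr => i _ do rewrite -scaler_nat (tnth_nth 0).
  by rewrite coord_sum_free// (basis_free Pib).
have natE b : b \in Delta -> coord Pi iq b = 1 ->
    exists c : 'I_n -> nat, b = \sum_i tnth Pi i *+ c i.
  move=> /Pic[c [->|->]] b1; first by exists c.
  have := ler0n C (c iq); rewrite -oppr_le0.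
  by move: b1; rewrite linearN /= coordE => ->; rewrite ler10.
move=> [mD ml] m1; have [c mE] := natE m mD m1.
have [k] := ubnP (\sum_i c i)%N; move: ml m1 mE; move Lm : (re_form m m) => L ml.
elim: k => // k IH in m c mD Lm *.
move=> m1 mE ck.
have lm : is_long Delta re_form m by split=> //; rewrite Lm.
have ciq : c iq = 1%N.
  by apply/eqP; rewrite -(eqr_nat C) -coordE -mE m1.
have Lsum : L = \sum_i (c i)%:R * re_form m (tnth Pi i).
  rewrite -Lm {2}mE (big_morph (re_form m)
    (fun a b => symform_Dr re_formC re_formDl a b m)
    (symform_0r re_formC re_formDl m)).
  by apply: eq_bigr => i _; rewrite (symform_Mnr re_formC re_formDl).
have [/existsP[i /andP[iiq Bi]]|/existsPn neg] :=
    boolP [exists i, (i != iq) && (0 < re_form m (tnth Pi i))].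
  have iD := simple_rootD i; have i_gt0 := re_form_gt0 iD.
  have im : tnth Pi i != m.
    apply: contra_eq_neq m1 => <-.
    by rewrite coordPi (negPf iiq) eq_sym oner_neq0.
  have Nim : - tnth Pi i != m.
    apply: contra_eq_neq m1 => <-.
    by rewrite linearN /= coordPi (negPf iiq) oppr0 eq_sym oner_neq0.
  have [|p [pE pD]] :=
    reflection_string_top h_cartan DeltaP normX Pi_simple iD mD im Nim.
    move=> j j0; apply: (nonroot_of_long lm).
    have j0R : 0 < j%:R :> R by rewrite ltr0n.
    rewrite (norm_addMn re_formC re_formDl) re_formC -addrA ltrDl addr_gt0//.
      by rewrite !mulr_gt0// re_formC.
    by rewrite !mulr_gt0.
  have {}pE : 2 * re_form (tnth Pi i) m = p%:R * re_form (tnth Pi i) (tnth Pi i).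
    apply: (@complexI R); rewrite !rmorphM !rmorph_nat /=.
    by rewrite -root_form_re ?inE ?mD ?orbT// -root_form_self_re.
  have p0 : (0 < p)%N.
    case: p pE pD => // /eqP; rewrite mul0r re_formC mulf_eq0 (gt_eqF Bi).
    by rewrite pnatr_eq0.
  have c1 : coord Pi iq (m - tnth Pi i *+ p) = 1.
    by rewrite linearB linearMn /= coordPi (negPf iiq) mul0rn subr0.
  have [c' c'E] := natE _ pD c1.
  apply: (IH (m - tnth Pi i *+ p) c') => //.
    rewrite -mulNrn (norm_addMn re_formC re_formDl) re_formNl.
    rewrite (re_formNl (tnth Pi i) (- _)) (symform_Nr re_formC re_formNl) opprK Lm -pE.
    by ring.
  rewrite -ltnS; apply: leq_trans ck; rewrite ltnS.
  have c'j j : c j = (c' j + (i == j) * p)%N.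
    apply/eqP; rewrite -(eqr_nat C) natrD natrM -!coordE -mE -c'E.
    by rewrite linearB linearMn /= coordPi mulr_natr subrK.
  rewrite [X in (_ < X)%N](eq_bigr _ (fun j _ => c'j j)).
  rewrite big_split /= -[X in (X < _)%N]addn0 ltn_add2l (bigD1 i)//= eqxx mul1n.
  by rewrite addn_gt0 p0.
have [->//|aqm] := eqVneq aq m.
have := long_le_half re_formC re_formDl re_formNl re_form_gt0
  re_form_separates re_form_integral lm (simple_rootD iq) aqm.
have : L <= re_form m aq.
  rewrite Lsum (bigD1 iq)//= ciq mul1r gerDl; apply: sumr_le0 => j jiq.
  by have := neg j; rewrite jiq /= -leNgt => ?; apply: mulr_ge0_le0.
by have := re_form_gt0 mD; rewrite Lm; lra.
Qed.

End AlphaQ.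

Let form_Nr := symform_Nr re_formC re_formNl.

Lemma long_half_sub a b : is_long Delta re_form a -> b \in Delta ->
  re_form a b = re_form a a / 2 -> a - b \in Delta.
Proof.
move=> [aD _] bD ab; have a_gt0 := re_form_gt0 aD.
apply: re_form_sub_root => //; first by rewrite re_formC ab; lra.
by apply: contra_eq_neq ab => ->; apply/eqP => E; lra.
Qed.

Lemma string_end_long m a b p : is_long Delta re_form m -> b + a *+ p \in Delta ->
  (forall j, (p < j)%N -> re_form m m < re_form (b + a *+ j) (b + a *+ j)) ->
  string_end Delta a b p.
Proof.
move=> ml bD pj; split=> // j; apply: contraTT; rewrite -ltnNge => /pj.
exact: (nonroot_of_long ml).
Qed.

Lemma struct_product_long a b : is_long Delta re_form a -> b \in Delta ->
  re_form a b = re_form a a / 2 -> N a (- b) * N (- a) b = - (form a a / 2).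
Proof.
move=> al bD ab; have abD := long_half_sub al bD ab.
have [aD _] := al; have a_gt0 := re_form_gt0 aD.
have NbD := rootN h_cartan DeltaP normX bD; have b_gt0 := re_form_gt0 NbD.
have s0 : string_end Delta (- a) (- b) 0.
  apply: (string_end_long al) => [|j]; first by rewrite addr0.
  apply: (norm_string_down re_formC re_formDl) => //.
    by rewrite re_formNl form_Nr opprK.
  by rewrite re_formNl form_Nr opprK.
have s1 : string_end Delta a (- b) 1.
  apply: (string_end_long al) => [|j]; first by rewrite addrC.
  by apply: (norm_string_up re_formC re_formDl); rewrite // form_Nr ab.
have := rn_product normX aD NbD abD s0 s1.
by rewrite opprK mul1n addn0 mulrAC mul1r.
Qed.

Lemma struct_product_sum_long m u v : is_long Delta re_form m ->
  u \in Delta -> v \in Delta -> u + v \in Delta ->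
  re_form u u = re_form m m -> re_form v v = re_form m m ->
  re_form u v = - (re_form m m / 2) ->
  N u v * N (- u) (- v) = - (form m m / 2).
Proof.
move=> ml uD vD uvD uu vv uv; have L_gt0 := re_form_gt0 (proj1 ml).
have v_gt0 := re_form_gt0 vD.
have s0 : string_end Delta (- u) v 0.
  apply: (string_end_long ml) => [|j]; first by rewrite addr0.
  apply: (norm_string_down re_formC re_formDl) => //.
    by rewrite re_formNl form_Nr opprK.
  by rewrite re_formNl uv opprK.
have s1 : string_end Delta u v 1.
  apply: (string_end_long ml) => [|j]; first by rewrite addrC.
  exact: (norm_string_up re_formC re_formDl).
rewrite (rn_product normX uD vD uvD s0 s1) mul1n addn0 mulrAC mul1r.
by rewrite !root_form_self_re ?uu//; case: ml.
Qed.

Lemma struct_product_sum_short m u v : is_long Delta re_form m ->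
  u \in Delta -> v \in Delta -> u + v \in Delta -> v - u \in Delta ->
  re_form u u = re_form m m / 2 -> re_form v v = re_form m m / 2 ->
  re_form u v = 0 ->
  N u v * N (- u) (- v) = - (form m m / 2).
Proof.
move=> ml uD vD uvD vuD uu vv uv; have L_gt0 := re_form_gt0 (proj1 ml).
have s1 w : v + w \in Delta -> re_form w w = re_form m m / 2 ->
    re_form w v = 0 -> string_end Delta w v 1.
  move=> vwD ww wv; apply: (string_end_long ml) => [|j]; first by rewrite mulr1n.
  exact: (norm_string_orthogonal re_formC re_formDl).
have sN : string_end Delta (- u) v 1.
  by apply: s1; rewrite // ?re_formNl ?form_Nr ?opprK ?uv ?oppr0.
have sP : string_end Delta u v 1 by apply: s1; rewrite // addrC.
rewrite (rn_product normX uD vD uvD sN sP) divff ?pnatr_eq0// mul1r.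
rewrite (root_form_self_re uD) uu (root_form_self_re (proj1 ml)).
by rewrite rmorphM fmorphV rmorph_nat.
Qed.

Section LongPairs.
Variables m e x x' c d : hdual.
Hypotheses (ml : is_long Delta re_form m) (el : is_long Delta re_form e).
Hypotheses (meD : m + e \notin Delta) (me0 : m + e != 0).
Hypotheses (xD : x \in Delta) (xD' : x' \in Delta) (xE : x + x' = m + e).
Hypotheses (cD : c \in Delta) (dD : d \in Delta) (cdE : c + d = m + e).
Hypotheses (xm : x != m) (xe : x != e) (cm : c != m) (ce : c != e).
Hypotheses (cd : c != d) (xc : x != c) (xd : x != d).

Lemma struct_long_pairs :
  N x (- c) * N m (- x) * N (- d) x' * N (- x') e =
  N m (e - c) * N e (- c) * (form m m / 2).
Proof.
pose pairP := long_pair re_formC re_formDl re_formNl re_form_gt0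
  re_form_separates re_form_integral.
pose lengthP := long_pair_lengths re_formC re_formDl re_formNl re_form_gt0
  re_form_separates re_form_integral.
have DN a : a \in Delta -> - a \in Delta := rootN h_cartan DeltaP normX (a := a).
have me_ge0 := long_nonsum_ge0 re_formNl re_form_sub_root DN ml el meD me0.
have [mD lm] := ml; have [eD le] := el; have L_gt0 := re_form_gt0 mD.
have eL := is_long_eq ml el.
have [me [mx ex] [mx' ex'] xxx' xxx''] := pairP _ _ _ _ ml el me_ge0 xD xD' xE xm xe.
have [_ [mc ec] [md ed] ccd ddc] := pairP _ _ _ _ ml el me_ge0 cD dD cdE cm ce.
have [[cc cd0]|[cd' _]] := lengthP _ _ _ _ ml el me_ge0 cD dD cdE cm ce; last first.
  by have := cd; rewrite cd' eqxx.
have dd : re_form d d = re_form m m by rewrite -ddc cd0 addr0.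
have cl : is_long Delta re_form c by split=> // b /lm; rewrite cc.
have dl : is_long Delta re_form d by split=> // b /lm; rewrite dd.
have cd_ge0 : 0 <= re_form c d by rewrite cd0.
have xEcd : x + x' = c + d by rewrite xE cdE.
have [_ [cx dx] [cx' dx'] _ _] := pairP _ _ _ _ cl dl cd_ge0 xD xD' xEcd xc xd.
have mxD : m - x \in Delta by apply: long_half_sub.
have cxD : x - c \in Delta.
  by rewrite -opprB DN//; apply: long_half_sub.
have mcD : m - c \in Delta by apply: long_half_sub.
have exD : e - x' \in Delta by apply: long_half_sub => //; rewrite -eL.
have dxD : x' - d \in Delta.
  by rewrite -opprB DN//; apply: long_half_sub => //; rewrite dd -cc.
have edD : e - d \in Delta by apply: long_half_sub => //; rewrite -eL.
have ecD : e - c \in Delta by apply: long_half_sub => //; rewrite -eL.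
have mdD : m - d \in Delta by apply: long_half_sub.
have xx_gt0 := re_form_gt0 xD; have x'x'_gt0 := re_form_gt0 xD'.
have norm_neq0 l a : l \in Delta -> re_form l l < re_form a a -> a != 0.
  move=> /re_form_gt0 l_gt0.
  by apply: contraTneq => ->; rewrite (symform_0l re_formDl) -leNgt ltW.
have mxc_norm := norm_sub_sub re_formC re_formDl re_formNl xx_gt0 cc mx mc cx.
have ex'e : re_form e x' = re_form e e / 2 by rewrite -eL.
have de : re_form d d = re_form e e by rewrite dd.
have ede : re_form e d = re_form e e / 2 by rewrite -eL.
have dx'd : re_form d x' = re_form d d / 2 by rewrite dd -cc.
have exd_norm :=
  norm_sub_sub re_formC re_formDl re_formNl x'x'_gt0 de ex'e ede dx'd.
have T1 := struct_triangle h_cartan DeltaP normX mD xD cD mxD cxD mcD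
  (nonroot_of_long ml mxc_norm) (norm_neq0 _ _ mD mxc_norm)
  (struct_product_long ml xD mx).
have T2 := struct_triangle h_cartan DeltaP normX eD xD' dD exD dxD edD
  (nonroot_of_long el exd_norm) (norm_neq0 _ _ eD exd_norm)
  (struct_product_long el xD' ex'e).
have formE : form e e = form m m by rewrite !root_form_self_re// eL.
have exE : e - x' = - (m - x).
  by rewrite opprB; apply/eqP; rewrite subr_eq addrAC xE addrC addKr.
have dxE : x' - d = - (x - c).
  by rewrite opprB; apply/eqP; rewrite subr_eq addrAC cdE -xE addrC addKr.
rewrite exE dxE formE in T2.
have mxcD : m - x + (x - c) \in Delta by rewrite addrA subrK.
have K : N (m - x) (x - c) * N (- (m - x)) (- (x - c)) = - (form m m / 2).
  have uu := norm_sub re_formC re_formDl re_formNl mx.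
  have vv := norm_subr re_formC re_formDl re_formNl cx.
  have uv := form_sub_sub re_formC re_formDl re_formNl cc mx mc cx.
  have [[xx _]|[xx' xx]] := lengthP _ _ _ _ ml el me_ge0 xD xD' xE xm xe.
    apply: struct_product_sum_long => //; rewrite ?uu ?vv ?uv ?xx//.
    by rewrite {2}(splitr (re_form m m)) opprD addrA subrr sub0r.
  have {}xx : re_form x x = re_form m m / 2.
    by rewrite -xx mulrAC divff ?mul1r// pnatr_eq0.
  apply: struct_product_sum_short; rewrite ?uu ?vv ?uv ?xx ?subrr//.
  have -> : x - c - (m - x) = d - m; last by rewrite -opprB DN.
  apply/eqP; rewrite opprB addrACA -opprD subr_eq {2}xx' xEcd.
  by rewrite (addrC c m) addrA subrK addrC.
have S := struct_swap h_cartan DeltaP normX mD eD cD dD (esym cdE) me0 meD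
  mcD ecD mdD edD.
rewrite S.
rewrite (struct_antisym normX (DN _ dD) xD'); last by rewrite addrC.
rewrite (struct_antisym normX (DN _ xD') eD); last by rewrite addrC.
have f0 : - (form m m / 2) != 0.
  by rewrite oppr_eq0 mulf_neq0 ?invr_neq0 ?pnatr_eq0// gt_eqF//
     (root_form_self_gt0 h_cartan DeltaP normX Pi_simple).
apply: (mulIf f0); rewrite -{1}K.
move: T1 T2 {K S}; move: (form m m / 2) => f.
move: (N x (- c)) (N m (- x)) (N x' (- d)) (N e (- x')) (N (m - x) _) (N (- (m - x)) _)
  (N m (- c)) (N e (- d)) => n1 n2 n3 n4 k1 k2 n5 n6 T1 T2.
transitivity ((n2 * n1 * k1) * (n4 * n3 * k2)); first by ring.
by rewrite T1 T2; ring.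
Qed.

End LongPairs.

End RealRootForm.

Section RootCoordinates.
Variables (C : numFieldType) (g : lieAlgType C) (h : {vspace g}).
Local Notation hdual := 'Hom(subvs_of h, C^o).
Variables (Delta : seq hdual) (n : nat) (Pi : n.-tuple hdual).

Lemma coord_eval i : exists H0 : subvs_of h,
  forall a : hdual, a H0 = coord Pi i a.
Proof.
pose b := vbasis {:subvs_of h}.
pose bd j : hdual := linfun (coord b j : subvs_of h -> C^o).
exists (\sum_j coord Pi i (bd j) *: b`_j) => a.
have {2}-> : a = \sum_(j < \dim {:subvs_of h}) (a b`_j : C) *: bd j.
  apply/lfunP => H; rewrite {1}(coord_vbasis (memvf H)) linear_sum sum_lfunE /=.
  by apply: eq_bigr => j _; rewrite linearZ scale_lfunE lfunE; exact: mulrC.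
rewrite !linear_sum /=; apply: eq_bigr => j _.
by rewrite !linearZ /= mulrC.
Qed.

Lemma coord_root_space_sum i k (a : hdual) (x : g) :
  x != 0 -> x \in root_space a ->
  x \in (\sum_(b <- Delta | coord Pi i b == k) root_space b)%VS ->
  coord Pi i a = k.
Proof.
move=> x0 /root_spaceP xa xS; have [H0 H0E] := coord_eval i.
have : x \in lker (ad (vsval H0) - k *: \1)%VF.
  move: x xS {x0 xa}; apply/subvP.
  apply: (big_ind (fun U : {vspace g} => (U <= _)%VS)) => [|U W UK WK|b /eqP bk].
  - exact: sub0v.
  - by rewrite subv_add UK.
  - apply/subvP => y /root_spaceP yb.
    by rewrite memv_ker !lfunE /= opp_lfunE scale_lfunE id_lfunE adE yb H0E bk subrr.
rewrite memv_ker !lfunE /= opp_lfunE scale_lfunE id_lfunE adE xa H0E.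
by rewrite -scalerBl scaler_eq0 (negPf x0) orbF subr_eq0 => /eqP.
Qed.

Hypothesis DeltaP : enumerates_roots Delta.

Lemma coord_roots_of i k (a : hdual) :
  a \in roots_of Delta (\sum_(b <- Delta | coord Pi i b == k) root_space b)%VS ->
  a \in Delta /\ coord Pi i a = k.
Proof.
rewrite mem_filter => /andP[sub aD]; split=> //.
move: (aD); rewrite DeltaP => /andP[_ a0].
apply: (@coord_root_space_sum _ _ _ (vpick (root_space a))).
- by rewrite vpick0.
- exact: memv_pick.
- exact: (subvP sub) (memv_pick _).
Qed.

End RootCoordinates.

Theorem lemma6p39 (R : realType) (g : lieAlgType R[i]) (h : {vspace g})
    (Delta : seq 'Hom(subvs_of h, R[i]^o))
    (T : dynkin) (Pi : (rank T).-tuple 'Hom(subvs_of h, R[i]^o))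
    (iq : 'I_(rank T))
    (X : 'Hom(subvs_of h, R[i]^o) -> g)
    (Hc : 'Hom(subvs_of h, R[i]^o) -> subvs_of h)
    (N : 'Hom(subvs_of h, R[i]^o) -> 'Hom(subvs_of h, R[i]^o) -> R[i])
    (mu gamma epsilon : 'Hom(subvs_of h, R[i]^o))
    (V : {vspace tensor_sq g})
    (alpha gamma_j : 'Hom(subvs_of h, R[i]^o)) :
  lie_simple g -> cartan_subalgebra h -> enumerates_roots Delta ->
  simple_system Delta Pi -> has_type Pi ->
  quasi_heisenberg Delta Pi iq -> listed_type T iq.+1 ->
  root_normalization Delta X Hc N ->
  is_highest_weight_g1 Delta Pi iq mu ->
  is_highest_root Delta Pi gamma ->
  epsilon \in roots_of Delta (g1 Delta Pi iq) ->
  special_constituent Delta Pi iq mu gamma V (mu + epsilon) ->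
  type_1a Delta mu epsilon ->
  alpha \in roots_of_at Delta (mu + epsilon) (g1 Delta Pi iq) ->
  alpha \notin [:: mu; epsilon] ->
  gamma_j \in roots_of_at Delta (mu + epsilon) (z_n Delta Pi iq) ->
  let theta (beta : 'Hom(subvs_of h, R[i]^o)) := mu + epsilon - beta in
  N alpha (- gamma_j) * N mu (- alpha) *
    N (- theta gamma_j) (theta alpha) * N (- theta alpha) (theta mu) =
  N mu (epsilon - gamma_j) * N epsilon (- gamma_j) *
    (root_form (alpha_q Pi iq) (alpha_q Pi iq) / 2).
Proof.
move=> _ cartan DeltaP simple _ _ _ normX [v [vg1 v0 vmu _]] _ eg1 _.
move=> [meD em lm le] al_at al_me ga_at theta.
have ml := long_root_re lm; have el := long_root_re le.
have muc : coord Pi iq mu = 1.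
  by apply: coord_root_space_sum v0 _ vg1; apply/root_spaceP.
have [eD ec] := coord_roots_of DeltaP eg1.
move: al_at; rewrite mem_filter => /andP[xD' /(coord_roots_of DeltaP)[xD xc]].
move: ga_at; rewrite mem_filter => /andP[dD /(coord_roots_of DeltaP)[cD cc]].
have dc : coord Pi iq (mu + epsilon - gamma_j) = 0.
  by rewrite linearB linearD /= muc ec cc -[2]/(1 + 1) subrr.
have neq (a b : 'Hom(subvs_of h, R[i]^o)) : coord Pi iq a != coord Pi iq b -> a != b.
  by apply: contraNneq => ->.
have n21 : 2 != 1 :> R[i] by rewrite (eqr_nat _ 2 1).
have n20 : 2 != 0 :> R[i] by rewrite pnatr_eq0.
have -> : theta mu = epsilon by rewrite /theta addrAC subrr add0r.
have [mD _] := lm.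
rewrite (root_form_self_re cartan DeltaP normX simple (simple_rootD simple iq)).
rewrite (alpha_q_is_long cartan DeltaP normX simple ml muc).
rewrite -(root_form_self_re cartan DeltaP normX simple mD).
move: al_me; rewrite !inE negb_or => /andP[xm xe].
apply: (struct_long_pairs cartan DeltaP normX simple ml el) => //.
- apply: contraTneq (_ : coord Pi iq (mu + epsilon) != 0) => [->|].
    by rewrite linear0 eqxx.
  by rewrite linearD /= muc ec.
- by rewrite addrC subrK.
- by rewrite addrC subrK.
- by apply: neq; rewrite cc muc.
- by apply: neq; rewrite cc ec.
- by apply: neq; rewrite cc dc.
- by apply: neq; rewrite cc xc eq_sym.
- by apply: neq; rewrite dc xc oner_neq0.
Qed.
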